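(* Let $x \in \mathbb{C}\setminus(\mathbb{R}^-\cup\{1\})$ and let $\nu\in\mathbb{C}$ with $\mathrm{Re}(\nu)<0$. Given a complex sequence $(K_b)_{b\geq1}$, the unique solution $(E_b)_{b\geq1}$ of the infinite lower-triangular system $$\sum_{\ell=1}^b(-1)^\ell\binom{b}{\ell}\,Q_{b,\ell}\,E_\ell=K_b,\qquad b\geq 1,$$ with $$Q_{b,\ell}=-\frac{\Gamma(b)\Gamma(1-b\nu)}{\Gamma(b-b\nu)}\,\frac{x^{1-b}}{1-x}\,F(\ell-b,-b\nu;-b;x),\qquad 1\leq\ell\leq b,$$ is given by $$E_b=(1-x)\sum_{\ell=1}^b(-1)^{\ell-1}\binom{b}{\ell}F(\ell-b,\ell\nu;\ell;x)\,x^{\ell-1}\,\frac{\Gamma(\ell-\ell\nu)}{\Gamma(\ell)\Gamma(1-\ell\nu)}\,K_\ell$$ for all $b\geq1$.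
   Context: $\mathbb{R}^-=\,]-\infty,0]$. For $1\le \ell\le b$ the Gauss hypergeometric function with first parameter $\ell-b$ is the polynomial $F(\ell-b,\beta;\gamma;x)=\sum_{m=0}^{b-\ell}\frac{(\ell-b)_m(\beta)_m}{(\gamma)_m\,m!}x^m$, where $(a)_m=a(a+1)\cdots(a+m-1)$, $(a)_0=1$ (well defined for $\gamma=-b$ since $m\le b-\ell<b$). *)

(* Defs.v *)
From HB Require Import structures.
From mathcomp Require Import all_boot all_order all_algebra.
From mathcomp Require Import complex.
From mathcomp Require Import all_classical all_reals all_analysis.

Set Implicit Arguments.
Unset Strict Implicit.
Unset Printing Implicit Defensive.

Import Order.TTheory GRing.Theory Num.Theory.
Import numFieldNormedType.Exports.

Local Open Scope classical_set_scope.
Local Open Scope ring_scope.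
Local Open Scope complex_scope.

(* The complex plane is R[i] over an arbitrary R : realType. *)

Definition cexp (R : realType) (z : R[i]) : R[i] :=
  (expR (complex.Re z))%:C * (cos (complex.Im z) +i* sin (complex.Im z)).

(* The rising factorial (a)_m = a (a+1) ... (a+m-1). *)
Definition poch (R : realType) (a : R[i]) (m : nat) : R[i] :=
  \prod_(k < m) (a + k%:R).

(* The Gamma function on C minus {0, -1, -2, ...}, by Euler's and Gauss's limit
     Gamma(z) = lim_n  n! n^z / (z (z+1) ... (z+n)),
   where n^z = exp (z ln n).  The regular algebra R[i]^o is what carries the
   library's topology on R[i], namely the one of the complex modulus.
   At the poles the value is irrelevant. *)
Definition gamma_seq (R : realType) (z : R[i]) (n : nat) : R[i] :=
  n`!%:R * cexp (z * (ln n%:R)%:C) / poch z n.+1.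

Definition Gamma (R : realType) (z : R[i]) : R[i] :=
  lim ((gamma_seq z : nat -> R[i]^o) @ \oo).

(* The terminating Gauss hypergeometric polynomial F(-n, beta; gamma; x);
   the first parameter is given by the natural number n, so that F(l-b, ...)
   is hypergeom_poly (b - l) ... when l <= b. *)
Definition hypergeom_poly (R : realType) (n : nat) (beta gamma x : R[i])
    : R[i] :=
  \sum_(0 <= m < n.+1)
    poch (- n%:R) m * poch beta m / (poch gamma m * m`!%:R) * x ^+ m.

Definition Qcoef (R : realType) (x nu : R[i]) (b l : nat) : R[i] :=
  - (Gamma b%:R * Gamma (1 - b%:R * nu) / Gamma (b%:R - b%:R * nu))
  * (x ^ (1 - b%:Z) / (1 - x))
  * hypergeom_poly (b - l) (- (b%:R * nu)) (- b%:R) x.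

(* Main.v *)
Require Import Defs.
From mathcomp Require Import all_boot all_order all_algebra.
From mathcomp Require Import complex.
From mathcomp Require Import all_classical all_reals all_analysis.
From mathcomp Require Import ring lra.
Set Implicit Arguments.
Unset Strict Implicit.
Unset Printing Implicit Defensive.
Import Order.TTheory GRing.Theory Num.Theory.
Local Open Scope ring_scope.
Local Open Scope complex_scope.

(* Row b of the system carries the factor
   Gamma(b) Gamma(1 - b nu) / Gamma(b - b nu) * x^(1-b) / (1 - x), which is
   harmless as soon as Gamma has no zero on Re z > 0.  There the logarithm of
   Euler's product, taken factor by factor as (ln |z| , atan (Im z / Re z)), has
   increments O(1/n^2), so the product tends to an exponential.

   It remains to invert (-1)^l C(b,l) F(l-b, -b nu; -b; x).  Writing p_m for
   (-b nu)_m x^m / m! and r_i for (k nu)_i x^i / i!, one has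
     C(b,l) F(l-b, -b nu; -b; x) = sum_m C(b-m, l) p_m,
     C(l,k) F(k-l, k nu; k; x) = sum_i (-1)^i C(l, k+i) (k+i)/k r_i,
   and orthogonality of binomials, sum_l (-1)^l C(N,l) C(l,j) = (-1)^j [N = j],
   reduces the product to sum_i (1 + i/k) r_i p_(b-k-i), where two applications
   of Chu-Vandermonde give opposite values unless b = k. *)

(** * Orthogonality of binomial coefficients *)

(** Both sides are the coefficient of X^j in (1 - (1 + X))^N = (-X)^N, the left one after binomial
    expansion. The upper bound [M] is free because C(N,l) vanishes for l > N. *)
Lemma sum_alt_bin_bin (A : comNzRingType) (N j M : nat) : (N <= M)%N ->
  \sum_(l < M.+1) (-1) ^+ l * 'C(N, l)%:R * 'C(l, j)%:R
  = (-1) ^+ j * (N == j)%:R :> A.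
Proof.
move=> leNM.
have coef_1X l : ((1 + 'X : {poly A}) ^+ l)`_j = 'C(l, j)%:R.
  rewrite exprDn coef_sum.
  under eq_bigr do rewrite expr1n mul1r coefMn coefXn.
  have [ltjl|lejl] := leqP l.+1 j.
    rewrite bin_small //= big1 // => i _.
    by rewrite gtn_eqF ?mul0rn // (leq_trans (ltn_ord i)).
  rewrite (bigD1 (Ordinal lejl)) //= eqxx big1 ?addr0 // => i.
  by rewrite -val_eqE eq_sym => /negPf /= ->; rewrite mul0rn.
transitivity (((1 - (1 + 'X) : {poly A}) ^+ N)`_j).
  rewrite exprDn coef_sum (big_ord_widen M.+1
    (fun l => ((1 ^+ (N - l) * (- (1 + 'X)) ^+ l : {poly A}) *+ 'C(N, l))`_j)) //.
  rewrite [RHS]big_mkcond; apply: eq_bigr => l _.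
  rewrite ltnS; case: leqP => [_|ltNl]; last by rewrite bin_small ?mulr0 ?mul0r.
  rewrite expr1n mul1r coefMn -scaleN1r exprZn.
  by rewrite coefZ coef_1X -[RHS]mulr_natr mulrAC.
rewrite opprD addrA subrr add0r -scaleN1r exprZn.
rewrite coefZ coefXn [j == N]eq_sym.
by case: eqP => [->|_] //=; rewrite !mulr0.
Qed.

(** * Rising factorials, Chu-Vandermonde and the inverse hypergeometric matrices *)

Section Algebra.
Variable R : realType.
Implicit Types (a c x nu : R[i]).

Lemma natC_neq0 n : (0 < n)%N -> n%:R != 0 :> R[i].
Proof. by rewrite pnatr_eq0 -lt0n. Qed.

Lemma factC_neq0 n : n`!%:R != 0 :> R[i].
Proof. by rewrite natC_neq0 ?fact_gt0. Qed.

Lemma poch0 a : poch a 0 = 1.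
Proof. by rewrite /poch big_ord0. Qed.

Lemma pochS a m : poch a m.+1 = poch a m * (a + m%:R).
Proof. by rewrite /poch big_ord_recr. Qed.

Lemma pochSl a m : poch a m.+1 = a * poch (a + 1) m.
Proof.
rewrite /poch big_ord_recl addr0; congr (_ * _).
by apply: eq_bigr => i _; rewrite lift0 -addrA -natr1 [1 + _]addrC.
Qed.

Lemma poch_nat k m : (0 < k)%N ->
  poch k%:R m = ((k + m).-1)`!%:R / (k.-1)`!%:R :> R[i].
Proof.
case: k => // k _; elim: m => [|m IHm].
  by rewrite poch0 addn0 divff ?factC_neq0.
by rewrite pochS IHm addnS addSn /= factS natrM -addSn natrD mulrAC [X in _ = X / _]mulrC.
Qed.

Lemma poch_Nnat n m : (m <= n)%N ->
  poch (- n%:R) m = (-1) ^+ m * n`!%:R / (n - m)`!%:R :> R[i].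
Proof.
elim: m => [_|m IHm ltmn]; first by rewrite poch0 subn0 mul1r divff ?factC_neq0.
rewrite pochS IHm; last exact: ltnW.
have -> : (n - m = (n - m.+1).+1)%N by rewrite subnSK.
rewrite factS natrM exprS.
have -> : - n%:R + m%:R = - (n - m.+1).+1%:R :> R[i].
  by rewrite subnSK // natrB ?opprB 1?addrC // ltnW.
move: (natC_neq0 (ltn0Sn (n - m.+1))) (factC_neq0 (n - m.+1)).
by move: (n - m.+1).+1%:R (n - m.+1)`!%:R => p q hp hq; field; rewrite hp hq.
Qed.

(** The coefficient of t^m in the binomial series (1 - t)^(-a). *)
Definition pochdiv a m : R[i] := poch a m / m`!%:R.

Lemma pochdiv0 a : pochdiv a 0 = 1.
Proof. by rewrite /pochdiv poch0 divr1. Qed.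

Lemma pochdivS a m : m.+1%:R * pochdiv a m.+1 = (a + m%:R) * pochdiv a m.
Proof.
rewrite /pochdiv pochS factS natrM.
move: (natC_neq0 (ltn0Sn m)) (factC_neq0 m).
by move: m.+1%:R m`!%:R => p q hp hq; field; rewrite hp hq.
Qed.

Lemma pochdivSl a m : m.+1%:R * pochdiv a m.+1 = a * pochdiv (a + 1) m.
Proof.
rewrite /pochdiv pochSl factS natrM.
move: (natC_neq0 (ltn0Sn m)) (factC_neq0 m).
by move: m.+1%:R m`!%:R => p q hp hq; field; rewrite hp hq.
Qed.

(** Induction on n: multiply by n + 1 = i + (n + 1 - i) and let each part lower the index of its own
    factor through [pochdivS]; the two coefficients then add up to a + c + n. *)
Lemma chu_vandermonde a c n :
  \sum_(i < n.+1) pochdiv a i * pochdiv c (n - i) = pochdiv (a + c) n.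
Proof.
elim: n => [|n IHn]; first by rewrite big_ord1 !pochdiv0 mulr1.
apply: (mulfI (natC_neq0 (ltn0Sn n))).
rewrite pochdivS -IHn !mulr_sumr.
transitivity (\sum_(i < n.+2) i%:R * pochdiv a i * pochdiv c (n.+1 - i)
   + \sum_(i < n.+2) pochdiv a i * ((n.+1 - i)%:R * pochdiv c (n.+1 - i))).
  rewrite -big_split /=; apply: eq_bigr => i _.
  by rewrite natrB -1?ltnS //; ring.
rewrite big_ord_recl [X in _ + X]big_ord_recr /= subnn !mul0r mulr0 add0r addr0.
rewrite -big_split /=; apply: eq_bigr => i _.
have lein : (i <= n)%N by rewrite -ltnS.
rewrite /bump /= add1n subSS pochdivS subSn // pochdivS.
by rewrite natrB //; ring.
Qed.

(** Termwise, C(b,l) (l-b)_m / (-b)_m = C(b-m,l), the signs cancelling. This vanishes for m > b - l,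
    so the range of m can be made independent of l. *)
Lemma bin_mul_hypergeom_Nnat b l c x : (l <= b)%N ->
  'C(b, l)%:R * hypergeom_poly (b - l) c (- b%:R) x
  = \sum_(m < b.+1) 'C(b - m, l)%:R * (pochdiv c m * x ^+ m).
Proof.
move=> lelb; rewrite /hypergeom_poly big_mkord.
rewrite (big_ord_widen b.+1 (fun m => poch (- (b - l)%:R) m * poch c m /
  (poch (- b%:R) m * m`!%:R) * x ^+ m)) ?ltnS ?leq_subr //.
rewrite big_mkcond mulr_sumr; apply: eq_bigr => m _.
have lemb : (m <= b)%N by rewrite -ltnS.
rewrite ltnS; case: leqP => [lem|ltm]; last first.
  by rewrite [X in _ = X%:R * _]bin_small ?mulr0 ?mul0r // ltn_subCl // ltnW.
rewrite !poch_Nnat // /pochdiv [LHS]mulrA [RHS]mulrA; congr (_ * _).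
have lel : (l <= b - m)%N by rewrite leq_subCr.
have/(congr1 (fun n => n%:R : R[i])) := bin_fact lelb; rewrite !natrM.
have/(congr1 (fun n => n%:R : R[i])) := bin_fact lel; rewrite !natrM.
rewrite subnAC.
have := signr_eq0 R[i] m.
move: (factC_neq0 m) (factC_neq0 (b - l)) (factC_neq0 (b - l - m)) (factC_neq0 l)
  (factC_neq0 b) (factC_neq0 (b - m)).
move: 'C(b, l)%:R 'C(b - m, l)%:R m`!%:R (b - l)`!%:R (b - l - m)`!%:R l`!%:R.
move: b`!%:R (b - m)`!%:R ((-1) ^+ m) (poch c m) => fb fbm s p c1 c2 fm fbl fblm fl.
move=> hm hbl hblm hl hb hbm /negbT hs E2 E1.
move: hb hbm; rewrite -E1 -E2 !mulf_eq0 !negb_or => /and3P[hc1 _ _] /and3P[hc2 _ _].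
by field; rewrite hm hbl hblm hl hs hc1 hc2.
Qed.

(** Termwise, C(l,k) (k-l)_i / (k)_i = (-1)^i C(l,k+i) (k+i)/k. Again the vanishing binomial allows
    a range of i independent of l. *)
Lemma bin_mul_hypergeom_nat b l k c x : (l <= b)%N -> (0 < k)%N ->
  'C(l, k)%:R * hypergeom_poly (l - k) c k%:R x
  = \sum_(i < b.+1) 'C(l, k + i)%:R *
      ((-1) ^+ i * ((k + i)%:R / k%:R * pochdiv c i * x ^+ i)).
Proof.
move=> lelb k0.
have [lekl|ltlk] := leqP k l; last first.
  rewrite bin_small // mul0r big1 // => i _.
  by rewrite bin_small ?mul0r // ltn_addr.
rewrite /hypergeom_poly big_mkord.
rewrite (big_ord_widen b.+1 (fun i => poch (- (l - k)%:R) i * poch c i /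
  (poch k%:R i * i`!%:R) * x ^+ i)); last first.
  by rewrite ltnS (leq_trans (leq_subr _ _)).
rewrite big_mkcond mulr_sumr; apply: eq_bigr => i _.
rewrite ltnS; case: leqP => [lei|lti]; last first.
  by rewrite [X in _ = X%:R * _]bin_small ?mulr0 ?mul0r // -ltn_subLR.
rewrite poch_Nnat // poch_nat // /pochdiv !mulrA; congr (_ * _).
have leil : (k + i <= l)%N by rewrite -leq_subRL.
have/(congr1 (fun n => n%:R : R[i])) := bin_fact lekl; rewrite !natrM.
have/(congr1 (fun n => n%:R : R[i])) := bin_fact leil; rewrite !natrM subnDA.
have -> : k`! = (k * (k.-1)`!)%N by case: (k) k0.
have -> : (k + i)`! = ((k + i) * ((k + i).-1)`!)%N by case: (k) k0.
rewrite !natrM.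
move: (natC_neq0 k0) (factC_neq0 i) (factC_neq0 (l - k))
  (factC_neq0 (l - k - i)) (factC_neq0 k.-1) (factC_neq0 (k + i).-1).
move: 'C(l, k)%:R 'C(l, k + i)%:R i`!%:R (l - k)`!%:R (l - k - i)`!%:R.
move: (k.-1)`!%:R ((k + i).-1)`!%:R k%:R (k + i)%:R ((-1) ^+ i) (poch c i).
move=> f1 f2 k' ki s p c1 c2 fi flk flki hk hi hlk hlki hf1 hf2 <- E.
have -> : c1 = c2 * (ki * f2 * flki) / (k' * f1 * flk).
  by rewrite -E; field; rewrite hk hf1 hlk.
by field; rewrite hk hi hlk hlki hf1 hf2.
Qed.

(* The convolution of [(k + i) / k * (k nu)_i / i!] with [(- b nu)_m / m!]:
   the two halves [1] and [i / k] of the weight cancel after Vandermonde. *)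
Lemma weighted_vandermonde k n nu : (0 < k)%N ->
  \sum_(i < n.+1) (k + i)%:R / k%:R * pochdiv (k%:R * nu) i *
     pochdiv (- ((k + n)%:R * nu)) (n - i) = (n == 0)%:R.
Proof.
move=> k0; have hk := natC_neq0 k0.
transitivity (\sum_(i < n.+1) pochdiv (k%:R * nu) i *
     pochdiv (- ((k + n)%:R * nu)) (n - i) +
  \sum_(i < n.+1) k%:R^-1 * (i%:R * pochdiv (k%:R * nu) i) *
     pochdiv (- ((k + n)%:R * nu)) (n - i)).
  rewrite -big_split /=; apply: eq_bigr => i _.
  by rewrite natrD; field.
rewrite chu_vandermonde.
case: n => [|n]; first by rewrite big_ord1 /= !mul0r !mulr0 mul0r addr0 pochdiv0.
rewrite big_ord_recl !mul0r mulr0 mul0r add0r /=.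
(* The weight i is absorbed by [pochdivSl], which produces the factor k nu; its k cancels the k in
   the denominator. *)
transitivity (pochdiv (k%:R * nu - (k + n.+1)%:R * nu) n.+1 +
  nu * \sum_(i < n.+1) pochdiv (k%:R * nu + 1) i *
     pochdiv (- ((k + n.+1)%:R * nu)) (n - i)).
  congr (_ + _); rewrite mulr_sumr; apply: eq_bigr => i _.
  rewrite /bump /= add1n subSS pochdivSl.
  by field.
rewrite chu_vandermonde.
(* Times n + 1, the two terms become -(n+1) nu and +(n+1) nu times the same
   [pochdiv (1 - (n+1) nu) n]. *)
apply: (mulfI (natC_neq0 (ltn0Sn n))).
rewrite mulrDr pochdivSl mulr0.
have -> : k%:R * nu - (k + n.+1)%:R * nu = - (n.+1%:R * nu) by rewrite natrD; ring.
have -> : k%:R * nu + 1 - (k + n.+1)%:R * nu = - (n.+1%:R * nu) + 1.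
  by rewrite natrD; ring.
by ring.
Qed.

Lemma hypergeom_inverse b k nu x : (0 < k)%N -> (k <= b)%N ->
  \sum_(l < b.+1) ((-1) ^+ l * 'C(b, l)%:R *
       hypergeom_poly (b - l) (- (b%:R * nu)) (- b%:R) x) *
     ((-1) ^+ k * 'C(l, k)%:R * hypergeom_poly (l - k) (k%:R * nu) k%:R x)
  = (k == b)%:R.
Proof.
move=> k0 lekb.
pose p m := pochdiv (- (b%:R * nu)) m * x ^+ m.
pose w i := (k + i)%:R / k%:R * pochdiv (k%:R * nu) i * x ^+ i.
transitivity (\sum_(l < b.+1) \sum_(i < b.+1) \sum_(m < b.+1)
   (-1) ^+ (k + i) * p m * w i * ((-1) ^+ l * 'C(b - m, l)%:R * 'C(l, k + i)%:R)).
  apply: eq_bigr => l _.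
  have lelb : (l <= b)%N by rewrite -ltnS.
  rewrite -[_ * _ * hypergeom_poly (b - l) _ _ _]mulrA bin_mul_hypergeom_Nnat //.
  rewrite -[_ * _ * hypergeom_poly (l - k) _ _ _]mulrA (bin_mul_hypergeom_nat _ _ lelb) //.
  rewrite mulrCA mulrA mulr_sumr; apply: eq_bigr => i _.
  rewrite mulrCA !mulr_sumr mulr_suml mulr_sumr; apply: eq_bigr => m _.
  by rewrite /p /w exprD; ring.
(* The sum over l is carried out first, by orthogonality; its sign (-1)^(k+i) cancels the one
   already present. *)
transitivity (\sum_(i < b.+1) \sum_(m < b.+1) p m * w i * (b - m == k + i)%N%:R).
  rewrite exchange_big /=; apply: eq_bigr => i _.
  rewrite exchange_big /=; apply: eq_bigr => m _.
  rewrite -mulr_sumr sum_alt_bin_bin ?leq_subr //.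
  by rewrite mulrCA !mulrA -expr2 sqrr_sign mul1r.
(* Only m = b - k - i survives, and such an m exists only for i <= b - k. *)
transitivity (\sum_(i < (b - k).+1) p (b - k - i)%N * w i).
  rewrite [RHS](big_ord_widen b.+1 (fun i => p (b - k - i)%N * w i)); last first.
    by rewrite ltnS leq_subr.
  rewrite [RHS]big_mkcond; apply: eq_bigr => i _; rewrite ltnS.
  case: leqP => [lei|lti]; last first.
    rewrite big1 // => m _; rewrite [(_ == _)%N]ltn_eqF ?mulr0 //.
    by rewrite (leq_ltn_trans (leq_subr _ _)) // -ltn_subLR.
  have ltm : (b - k - i < b.+1)%N by rewrite ltnS -subnDA leq_subr.
  have leib : (k + i <= b)%N by rewrite -leq_subRL.
  rewrite (bigD1 (Ordinal ltm)) //= big1 ?addr0 => [|m].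
    by rewrite -subnDA subKn // eqxx mulr1.
  rewrite -val_eqE /= => hm; have lemb : (m <= b)%N by rewrite -ltnS.
  case: eqP => [E|]; last by rewrite mulr0.
  by move: hm; rewrite -subnDA -E subKn // eqxx.
(* The powers of x in [p] and [w] combine to x^(b-k), which is independent of i and equals 1 when b
   = k. *)
transitivity (x ^+ (b - k) * (b - k == 0)%N%:R); last first.
  have [->|nkb] := eqVneq k b; first by rewrite subnn expr0 mul1r.
  by rewrite subn_eq0 leqNgt ltn_neqAle nkb lekb mulr0.
rewrite -(weighted_vandermonde _ nu k0) subnKC // mulr_sumr; apply: eq_bigr => i _.
have lei : (i <= b - k)%N by rewrite -ltnS.
have -> : x ^+ (b - k) = x ^+ (b - k - i) * x ^+ i by rewrite -exprD subnK.
by rewrite /p /w; ring.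
Qed.

End Algebra.

(** * Real estimates for the logarithmic increments of Euler's product *)

Section RealEstimates.
Import numFieldNormedType.Exports.
Local Open Scope classical_set_scope.
Variable R : realType.
Implicit Types (u : nat -> R) (C p t y : R).

(* [u n + 2 C / n.+1] is nonincreasing and [u n - 2 C / n.+1] is nondecreasing. *)
Lemma cvg_increment_le u C :
  (forall n, `|u n.+1 - u n| <= C / n.+1%:R ^+ 2) -> cvgn u.
Proof.
move=> hu.
have C0 : 0 <= C by have := le_trans (normr_ge0 _) (hu 0%N); rewrite expr1n divr1.
(* The factor 2 comes from 1/(n+1) - 1/(n+2) = 1/((n+1)(n+2)) >= 1/(2 (n+1)^2). *)
pose h n : R := 2 * C * harmonic n.
have hh n : C / n.+1%:R ^+ 2 <= h n - h n.+1.
  rewrite /h /harmonic /= -mulrBr.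
  have -> : n.+1%:R^-1 - n.+2%:R^-1 = (n.+1%:R * n.+2%:R)^-1 :> R.
    have -> : n.+2%:R = n.+1%:R + 1 :> R by rewrite -natr1.
    have := ltr0Sn R n; move: n.+1%:R => m m0.
    by field; rewrite !gt_eqF // addr_gt0.
  rewrite [2 * C]mulrC -mulrA ler_wpM2l //.
  have m1 : 1 <= n.+1%:R :> R by rewrite ler1n.
  have -> : n.+2%:R = n.+1%:R + 1 :> R by rewrite -natr1.
  move: n.+1%:R m1 => m m1.
  have m0 : 0 < m by lra.
  rewrite ler_pdivlMr ?mulr_gt0 ?addr_gt0 // mulrC ler_pdivrMr ?exprn_gt0 //; nra.
have hh' n : `|u n.+1 - u n| <= h n - h n.+1 := le_trans (hu n) (hh n).
have hv : nonincreasing_seq (fun n => u n + h n).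
  apply/nonincreasing_seqP => n.
  by have := hh' n; rewrite ler_norml => /andP[]; lra.
have hw : nondecreasing_seq (fun n => u n - h n).
  apply/nondecreasing_seqP => n.
  by have := hh' n; rewrite ler_norml => /andP[]; lra.
have cv : cvgn (fun n => u n + h n).
  apply: nonincreasing_is_cvgn => //; exists (u 0%N - h 0%N) => _ [n _ <-].
  rewrite (le_trans (hw 0%N n _)) //= lerD2l.
  have : 0 <= h n by rewrite mulr_ge0 ?mulr_ge0 // harmonic_ge0.
  by lra.
have ch : cvgn h by apply: is_cvgMr; apply: cvgP; exact: cvg_harmonic.
have -> : u = (fun n => (u n + h n) - h n) by apply/funext => n; rewrite addrK.
exact: is_cvgB.
Qed.

(** From ln y <= y - 1 at y = 1/(1+t): ln (1+t) >= t/(1+t) = t - t^2/(1+t). *)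
Lemma ln1D_ge t : 0 <= t -> t - t ^+ 2 <= ln (1 + t).
Proof.
move=> t0; have t1 : 0 < 1 + t by lra.
have : ln (1 + t)^-1 <= (1 + t)^-1 - 1.
  rewrite -{1}[(1 + t)^-1](subrK 1) [_ - 1 + 1]addrC le_ln1Dx //.
  by rewrite ltrBrDl subrr invr_gt0.
rewrite lnV ?posrE // => h.
have : 1 - (1 + t)^-1 <= ln (1 + t) by lra.
apply: le_trans.
have -> : 1 - (1 + t)^-1 = t - t ^+ 2 / (1 + t) by field; rewrite gt_eqF.
by rewrite lerD2l lerN2 ler_pdivrMr // ler_peMr ?sqr_ge0 //; lra.
Qed.

(** By oddness y >= 0 may be assumed; the mean value theorem for atan z - z then gives the slope
    -c^2/(1+c^2), of size at most c^2 <= y^2. *)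
Lemma atan_sub_le y : `|atan y - y| <= `|y| ^+ 3.
Proof.
wlog y0 : y / 0 <= y => [hw|].
  have [|y0] := leP 0 y; first exact: hw.
  have := hw (- y); rewrite oppr_ge0 ltW // atanN normrN -opprD normrN.
  exact.
rewrite (ger0_norm y0).
pose f (z : R) := atan z - z.
have df (z : R) : is_derive z 1 f ((1 + z ^+ 2)^-1 - 1).
  exact: is_deriveB.
have [|c] := @MVT_segment R f (fun z => (1 + z ^+ 2)^-1 - 1) 0 y y0 (fun z _ => df z).
  by apply: derivable_within_continuous => z _; exact: ex_derive.
rewrite in_itv /= /f atan0 !subr0 => /andP[c0 cy] ->.
have c2 : 0 < 1 + c ^+ 2 by rewrite ltr_wpDr ?sqr_ge0.
have -> : (1 + c ^+ 2)^-1 - 1 = - (c ^+ 2 / (1 + c ^+ 2)).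
  by field; rewrite gt_eqF.
rewrite mulNr normrN ger0_norm; last by rewrite mulr_ge0 // divr_ge0 ?sqr_ge0 // ltW.
rewrite (exprSr y) ler_wpM2r // ler_pdivrMr //.
have : c ^+ 2 <= y ^+ 2 by rewrite ler_sqr.
have : 0 <= c ^+ 2 by rewrite sqr_ge0.
nra.
Qed.

Lemma ln_ratio_bounds p : 1 <= p ->
  p^-1 - p^-1 ^+ 2 <= ln (p + 1) - ln p <= p^-1.
Proof.
move=> p1; have p0 : 0 < p by lra.
rewrite -ln_div ?posrE ?addr_gt0 //.
have -> : (p + 1) / p = 1 + p^-1 by field; rewrite gt_eqF.
have r0 : 0 < p^-1 by rewrite invr_gt0.
by rewrite ln1D_ge ?(ltW r0) //= le_ln1Dx //; lra.
Qed.

(** The left side is the real part of an increment of [log_gamma_seq] at z = s + it. Factoring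
    (p+1)^2 out of the last logarithm cancels ln (p+1), and both s (ln (p+1) - ln p) and half of ln
    (1+y) are s/p + O(1/p^2). *)
Lemma re_log_gamma_increment_le (s t p : R) : 0 < s -> 1 <= p ->
  `|ln (p + 1) + s * (ln (p + 1) - ln p)
     - 2^-1 * ln ((s + (p + 1)) ^+ 2 + t ^+ 2)|
  <= (s + (s ^+ 2 + t ^+ 2) + (2 * s + (s ^+ 2 + t ^+ 2)) ^+ 2) / p ^+ 2.
Proof.
move=> s0 p1; have p0 : 0 < p by lra.
have /andP[L1 L2] := ln_ratio_bounds p1.
set rho := s ^+ 2 + t ^+ 2; have rho0 : 0 <= rho by rewrite addr_ge0 ?sqr_ge0.
(* Chosen so that (s+p+1)^2 + t^2 = (p+1)^2 (1+y). *)
pose q := (p + 1)^-1; pose y := 2 * s * q + rho * q ^+ 2.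
have q0 : 0 < q by rewrite invr_gt0 addr_gt0.
have r0 : 0 < p^-1 by rewrite invr_gt0.
have r1 : p^-1 <= 1 by rewrite invf_le1.
have qr : q <= p^-1 by rewrite lef_pV2 ?posrE ?addr_gt0 //; lra.
(* Exchanging 1/(p+1) for 1/p costs at most 1/p^2. *)
have rq : p^-1 - p^-1 ^+ 2 <= q.
  have -> : q = p^-1 - p^-1 * q by rewrite /q; field; rewrite !gt_eqF ?addr_gt0.
  nra.
have y0 : 0 <= y by rewrite addr_ge0 ?mulr_ge0 ?sqr_ge0 // ltW.
have -> : ln ((s + (p + 1)) ^+ 2 + t ^+ 2) = 2 * ln (p + 1) + ln (1 + y).
  rewrite [2 * _]mulr_natl -lnXn ?addr_gt0 // -lnM ?posrE; last 2 first.
  - by rewrite exprn_gt0 ?addr_gt0.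
  - by lra.
  congr ln; rewrite /y /rho /q; field; by rewrite gt_eqF ?addr_gt0.
have Y1 : ln (1 + y) <= y by rewrite le_ln1Dx; lra.
have Y2 := ln1D_ge y0.
rewrite -exprVn; move: L1 L2 Y1 Y2 y0.
move: (ln (1 + y)) (ln (p + 1)) (ln p) => l1 l2 l3 L1 L2 Y1 Y2 y0.
move: p^-1 r0 r1 qr rq L1 L2 => r r0 r1 qr rq L1 L2.
have q2 : q ^+ 2 <= r ^+ 2 by rewrite ler_sqr ?nnegrE ?(ltW q0) ?(ltW r0).
have rr : r ^+ 2 <= r by rewrite expr2 ler_piMr // ltW.
have h1 : s * q <= s * r by rewrite ler_pM2l.
have h2 : s * (r - r ^+ 2) <= s * q by rewrite ler_pM2l.
have h3 : rho * q ^+ 2 <= rho * r ^+ 2 by rewrite ler_wpM2l.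
have h4 : rho * r ^+ 2 <= rho * r by rewrite ler_wpM2l.
have y1 : y <= (2 * s + rho) * r by rewrite /y; lra.
have y2 : y ^+ 2 <= (2 * s + rho) ^+ 2 * r ^+ 2.
  by rewrite -exprMn ler_sqr ?nnegrE // (le_trans y0).
have y3 : y <= 2 * s * r + rho * r ^+ 2 by rewrite /y; lra.
have y4 : 2 * s * (r - r ^+ 2) <= y.
  have : 0 <= rho * q ^+ 2 by rewrite mulr_ge0 ?sqr_ge0.
  by rewrite /y; lra.
have U : s * (r - r ^+ 2) <= s * (l2 - l3) by rewrite ler_pM2l.
have V : s * (l2 - l3) <= s * r by rewrite ler_pM2l.
have W : 0 <= (2 * s + rho) ^+ 2 * r ^+ 2 by rewrite mulr_ge0 ?sqr_ge0.
have W' : 0 <= rho * r ^+ 2 by rewrite mulr_ge0 ?sqr_ge0.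
have W'' : 0 <= s * r ^+ 2 by rewrite mulr_ge0 ?sqr_ge0 // ltW.
by rewrite ler_norml; apply/andP; split; lra.
Qed.

(** The imaginary counterpart. With q = 1/(s+p+1), the error splits into replacing ln (p+1) - ln p
    by 1/p, then 1/p by q, then t q by its arctangent; these cost |t|/p^2, |t| (s+1)/p^2 and
    |t|^3/p^2. *)
Lemma im_log_gamma_increment_le (s t p : R) : 0 < s -> 1 <= p ->
  `|t * (ln (p + 1) - ln p) - atan (t / (s + (p + 1)))|
  <= (`|t| * (s + 2) + `|t| ^+ 3) / p ^+ 2.
Proof.
move=> s0 p1; have p0 : 0 < p by lra.
have /andP[L1 L2] := ln_ratio_bounds p1.
have sp0 : 0 < s + (p + 1) by rewrite !addr_gt0.
have r0 : 0 < p^-1 by rewrite invr_gt0.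
have r1 : p^-1 <= 1 by rewrite invf_le1.
pose q := (s + (p + 1))^-1; have q0 : 0 < q by rewrite invr_gt0.
have qr : q <= p^-1 by rewrite lef_pV2 ?posrE //; lra.
have rq : p^-1 - q = (s + 1) * (p^-1 * q).
  by rewrite /q; field; rewrite !gt_eqF.
rewrite -/q; have A := atan_sub_le (t * q).
have -> : t * (ln (p + 1) - ln p) - atan (t * q) =
  t * (ln (p + 1) - ln p - p^-1) + t * (p^-1 - q) - (atan (t * q) - t * q).
  by ring.
rewrite (le_trans (ler_normB _ _)) // mulrDl lerD //; last first.
  rewrite (le_trans A) // normrM exprMn ler_wpM2l ?exprn_ge0 // gtr0_norm //.
  by rewrite -exprVn !expr2 exprS expr2; nra.
rewrite (le_trans (ler_normD _ _)) // !normrM -mulrDr -mulrA ler_wpM2l //.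
rewrite -exprVn [`|p^-1 - q|]ger0_norm ?subr_ge0 // rq ler0_norm; last by lra.
have h : (s + 1) * (p^-1 * q) <= (s + 1) * p^-1 ^+ 2.
  by rewrite ler_wpM2l ?addr_ge0 ?(ltW s0) // expr2 ler_pM2l.
move: h L1 L2; move: p^-1 => r; lra.
Qed.

End RealEstimates.

(** * Complex logarithms and the non-vanishing of Gamma for Re z > 0 *)

Section ComplexGamma.
Import numFieldNormedType.Exports.
Local Open Scope classical_set_scope.
Variable R : realType.
Implicit Types (z w : R[i]).

Lemma cexpD z w : cexp (z + w) = cexp z * cexp w.
Proof.
case: z w => [a b] [c d]; rewrite /cexp /= expRD cosD sinD.
by apply/eqP; rewrite eq_complex /=; apply/andP; split; apply/eqP; ring.
Qed.

Lemma cexp0 : cexp 0 = 1 :> R[i].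
Proof. by rewrite /cexp /= expR0 cos0 sin0 mul1r. Qed.

Lemma cexp_neq0 z : cexp z != 0.
Proof.
apply/eqP => h; have := cexpD z (- z).
by rewrite h mul0r subrr cexp0 => /eqP; rewrite oner_eq0.
Qed.

Lemma cexpN z : cexp (- z) = (cexp z)^-1.
Proof.
apply: (mulfI (cexp_neq0 z)); rewrite -cexpD subrr cexp0 divff //.
exact: cexp_neq0.
Qed.

Lemma cexp_sum (F : nat -> R[i]) n :
  cexp (\sum_(k < n) F k) = \prod_(k < n) cexp (F k).
Proof. exact: (big_morph _ cexpD cexp0). Qed.

(** The principal logarithm on the half-plane Re z > 0, where the arctangent of Im z / Re z is the
    argument. *)
Definition clog z : R[i] :=
  (2^-1 * ln (complex.Re z ^+ 2 + complex.Im z ^+ 2))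
  +i* atan (complex.Im z / complex.Re z).

(** For z = a + ib with a > 0, |z| = a sqrt (1 + (b/a)^2), and the cosine of atan (b/a) is the
    inverse of this root, so the root cancels in both coordinates. *)
Lemma clogK z : 0 < complex.Re z -> cexp (clog z) = z.
Proof.
case: z => a b /= a0; rewrite /cexp /clog /=.
have a2 : 0 < a ^+ 2 by rewrite exprn_gt0.
have ab : 0 < a ^+ 2 + b ^+ 2 by rewrite ltr_pwDl ?sqr_ge0.
have e0 : 0 < 1 + (b / a) ^+ 2 by rewrite ltr_pwDl ?sqr_ge0.
have E : expR (2^-1 * ln (a ^+ 2 + b ^+ 2)) = a * Num.sqrt (1 + (b / a) ^+ 2).
  apply/eqP; rewrite -(@eqrXn2 _ 2) ?expR_ge0 ?mulr_ge0 ?sqrtr_ge0 ?ltW //.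
  rewrite -expRM_natl mulrA divff ?mul1r ?pnatr_eq0 // lnK ?posrE //.
  rewrite exprMn sqr_sqrtr ?ltW // mulrDr mulr1 -exprMn mulrCA divff ?mulr1 //.
  by rewrite gt_eqF.
have c : cos (atan (b / a)) = (Num.sqrt (1 + (b / a) ^+ 2))^-1 by exact: cos_atan.
have c0 : cos (atan (b / a)) != 0 by rewrite c invr_eq0 gt_eqF // sqrtr_gt0.
have s : sin (atan (b / a)) = b / a * cos (atan (b / a)).
  by rewrite -{2}[b / a]atanK /tan divfK.
have q0 : Num.sqrt (1 + (b / a) ^+ 2) != 0 by rewrite gt_eqF // sqrtr_gt0.
rewrite E s c; move: (Num.sqrt _) q0 => q q0.
apply/eqP; rewrite eq_complex /=; apply/andP.
by split; apply/eqP; field; rewrite q0 ?(gt_eqF a0).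
Qed.

Lemma clog_nat n : (0 < n)%N -> clog n%:R = (ln n%:R)%:C.
Proof.
move=> n0; have -> : n%:R = (n%:R)%:C :> R[i] by rewrite rmorph_nat.
rewrite /clog /= expr0n addr0 mul0r atan0 lnXn ?ltr0n //.
by rewrite -[X in _ * X]mulr_natl mulrA mulVf ?mul1r ?pnatr_eq0.
Qed.

Lemma cvg_complex (u v : nat -> R) (a b : R) : u @ \oo --> a -> v @ \oo --> b ->
  ((fun n => u n +i* v n) : nat -> R[i]^o) @ \oo --> ((a +i* b : R[i]) : R[i]^o).
Proof.
move=> ua vb; apply/cvgrPdist_lt => /= e.
(* The radius is an element of R[i]; being positive there forces it to be a positive real. *)
rewrite ltcE /= => /andP[/eqP e1 e0].
have -> : e = (complex.Re e)%:C by case: e e1 {e0} => x y /= ->.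
near=> n.
rewrite normc_def /= ltcR (@le_lt_trans _ _ (`|a - u n| + `|b - v n|)) //.
  rewrite -[leRHS]ger0_norm ?addr_ge0 // -sqrtr_sqr ler_wsqrtr //.
  rewrite -(real_normK (num_real (a - u n))) -(real_normK (num_real (b - v n))).
  have := normr_ge0 (a - u n); have := normr_ge0 (b - v n); nra.
rewrite [ltRHS]splitr ltrD //; near: n.
  by apply: (@cvgr_dist_lt _ _ _ _ _ u a ua); rewrite divr_gt0.
by apply: (@cvgr_dist_lt _ _ _ _ _ v b vb); rewrite divr_gt0.
Unshelve. all: by end_near. Qed.

(** The limit is stated as an exponential because this is what makes it nonzero. *)
Lemma cvg_cexp (u : nat -> R[i]) :
  cvgn (fun n => complex.Re (u n)) -> cvgn (fun n => complex.Im (u n)) ->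
  exists z, ((fun n => cexp (u n)) : nat -> R[i]^o) @ \oo --> (cexp z : R[i]^o).
Proof.
set a := limn (fun n => complex.Re (u n)); set b := limn (fun n => complex.Im (u n)).
move=> cu cv.
exists (a +i* b).
have E z : cexp z = (expR (complex.Re z) * cos (complex.Im z)) +i*
                    (expR (complex.Re z) * sin (complex.Im z)).
  by rewrite /cexp; apply/eqP; rewrite eq_complex /=; apply/andP;
    split; apply/eqP; ring.
rewrite E; under eq_fun do rewrite E.
have ce : expR (complex.Re (u n)) @[n --> \oo] --> expR a.
  by apply: continuous_cvg; [exact: continuous_expR|exact: cu].
have cc : cos (complex.Im (u n)) @[n --> \oo] --> cos b.
  by apply: continuous_cvg; [exact: continuous_cos|exact: cv].
have cs : sin (complex.Im (u n)) @[n --> \oo] --> sin b.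
  by apply: continuous_cvg; [exact: continuous_sin|exact: cv].
by apply: cvg_complex; apply: cvgM.
Qed.

(** A logarithm of [gamma_seq] summed factor by factor: no branch jump can occur, unlike with the
    principal logarithm of the product. *)
Definition log_gamma_seq z n : R[i] :=
  \sum_(k < n) clog k.+1%:R + z * (ln n%:R)%:C - \sum_(k < n.+1) clog (z + k%:R).

Lemma cexp_log_gamma_seq z n : 0 < complex.Re z ->
  cexp (log_gamma_seq z n) = gamma_seq z n.
Proof.
move=> z0; rewrite /log_gamma_seq cexpD cexpN cexpD /gamma_seq.
rewrite (cexp_sum (fun k => clog k.+1%:R)) (cexp_sum (fun k => clog (z + k%:R))).
congr (_ * _ / _); last first.
  apply: eq_bigr => k _; rewrite clogK //.
  by rewrite raddfD /= ltr_pwDl // -(rmorph_nat (real_complex R)) ler0n.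
rewrite -[RHS]mulr1.
elim: n => [|n IHn]; first by rewrite big_ord0 mulr1.
rewrite big_ord_recr /= IHn factS natrM clogK ?mulr1 1?mulrC //.
by rewrite -(rmorph_nat (real_complex R)) /= ltr0n.
Qed.

Lemma log_gamma_seq_increment z n :
  log_gamma_seq z n.+2 - log_gamma_seq z n.+1 =
    (ln n.+2%:R)%:C + z * (ln n.+2%:R - ln n.+1%:R)%:C - clog (z + n.+2%:R).
Proof.
rewrite /log_gamma_seq (big_ord_recr n.+1) [\sum_(k < n.+3) _]big_ord_recr /=.
by rewrite clog_nat // rmorphB /=; ring.
Qed.

Lemma Gamma_neq0 z : 0 < complex.Re z -> Gamma z != 0.
Proof.
case: z => a b z0; have a0 : 0 < a := z0; set z := a +i* b.
have natE n : n.+2%:R = n.+1%:R + 1 :> R by rewrite -natr1.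
(* The shift by one puts p = n + 1 >= 1 in the increment bounds and avoids ln 0. *)
have cRe : cvgn (fun n => complex.Re (log_gamma_seq z n.+1)).
  apply: cvg_increment_le => n; rewrite -raddfB log_gamma_seq_increment.
  rewrite -(rmorph_nat (real_complex R)) /= mulr0 subr0 addr0 natE.
  by apply: re_log_gamma_increment_le; rewrite ?ler1n.
have cIm : cvgn (fun n => complex.Im (log_gamma_seq z n.+1)).
  apply: cvg_increment_le => n; rewrite -raddfB log_gamma_seq_increment.
  rewrite -(rmorph_nat (real_complex R)) /= mulr0 !add0r addr0 natE.
  by apply: im_log_gamma_increment_le; rewrite ?ler1n.
have [w cw] := cvg_cexp cRe cIm.
suff -> : Gamma z = cexp w by exact: cexp_neq0.
have cg : (gamma_seq z : nat -> R[i]^o) @ \oo --> (cexp w : R[i]^o).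
  rewrite -cvg_shiftS; move: cw; under eq_fun do rewrite cexp_log_gamma_seq //.
  exact.
exact: (cvg_lim (@norm_hausdorff _ _) cg).
Qed.

End ComplexGamma.

(** * Triangular linear systems *)

Lemma hypergeom_poly0 (R : realType) (c d x : R[i]) : hypergeom_poly 0 c d x = 1.
Proof. by rewrite /hypergeom_poly big_nat1 !poch0 fact0 expr0 !mulr1 divr1. Qed.

(* A right inverse of a triangular matrix with nonzero diagonal solves the
   system; forward substitution gives uniqueness. *)
Lemma triangular_system_iff (F : fieldType) (A B : nat -> nat -> F)
    (K E : nat -> F) :
  (forall b, (0 < b)%N -> A b b != 0) ->
  (forall b k, (0 < k)%N -> (k <= b)%N ->
     \sum_(1 <= l < b.+1) A b l * B l k = (k == b)%:R) ->
  (forall l k, (l < k)%N -> B l k = 0) ->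
  (forall b, (0 < b)%N -> \sum_(1 <= l < b.+1) A b l * E l = K b) <->
  (forall b, (0 < b)%N -> E b = \sum_(1 <= k < b.+1) B b k * K k).
Proof.
move=> Abb AB Btri.
pose E' b := \sum_(1 <= k < b.+1) B b k * K k.
have AE' b : (0 < b)%N -> \sum_(1 <= l < b.+1) A b l * E' l = K b.
  move=> b0; transitivity
      (\sum_(1 <= l < b.+1) \sum_(1 <= k < b.+1) A b l * B l k * K k).
    apply: eq_big_nat => l /andP[_ ltlb].
    (* By triangularity of [B] the inner sum extends from k <= l to k <= b, after which the two sums
       can be exchanged. *)
    rewrite /E' mulr_sumr [RHS](@big_cat_nat _ _ _ l.+1) //=.
    rewrite [X in _ = _ + X]big_nat_cond [X in _ = _ + X]big1 ?addr0 => [|k].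
      by apply: eq_bigr => k _; rewrite mulrA.
    by case/andP=> /andP[/Btri -> _] _; rewrite mulr0 mul0r.
  rewrite exchange_big_nat /=.
  transitivity (\sum_(1 <= k < b.+1) (k == b)%:R * K k).
    apply: eq_big_nat => k /andP[k0 ltkb].
    by rewrite -mulr_suml AB.
  rewrite big_nat_recr //= eqxx mul1r big_nat_cond big1 ?add0r // => k.
  by case/andP=> /andP[_ ltkb] _; rewrite ltn_eqF ?mul0r.
split=> h b b0; last first.
  by rewrite -[RHS]AE' //; apply: eq_big_nat => l /andP[l0 _]; rewrite h.
elim/ltn_ind: b b0 => b IH b0; rewrite -/(E' b).
(* Row b holds for both [E] and [E']; the terms below the diagonal agree by induction, and the
   diagonal coefficient cancels. *)
have := h b b0; rewrite -[in RHS]AE' // !big_nat_recr //=.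
rewrite [X in X + _ = _](_ : _ = \sum_(1 <= l < b) A b l * E' l).
  by move/addrI/(mulfI (Abb b b0)).
by apply: eq_big_nat => l /andP[l0 ltlb]; rewrite IH.
Qed.

(** * Removal of the Gamma factors and inversion of the system *)

Theorem corollary4p1 (R : realType) (x nu : R[i])
    (hx_cut : forall r : R, r <= 0 -> x <> r%:C)
    (hx1 : x <> 1)
    (hnu : complex.Re nu < 0)
    (K E : nat -> R[i]) :
  (forall b : nat, (1 <= b)%N ->
     \sum_(1 <= l < b.+1)
       (-1) ^+ l * 'C(b, l)%:R * Qcoef x nu b l * E l = K b)
  <->
  (forall b : nat, (1 <= b)%N ->
     E b = (1 - x) *
       \sum_(1 <= l < b.+1)
         (-1) ^+ (l - 1) * 'C(b, l)%:R *
         hypergeom_poly (b - l) (l%:R * nu) l%:R x * x ^+ (l - 1) *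
         (Gamma (l%:R - l%:R * nu) / (Gamma l%:R * Gamma (1 - l%:R * nu))) *
         K l).
Proof.
have x0 : x != 0 by apply/eqP => h; apply: (hx_cut 0).
have x1 : 1 - x != 0 by rewrite subr_eq0 eq_sym; apply/eqP.
have Re_nat n : complex.Re (n%:R : R[i]) = n%:R.
  by rewrite -(rmorph_nat (real_complex R)).
have Re_nu b : (0 < b)%N -> complex.Re (b%:R * nu) < 0.
  move=> b0; rewrite -(rmorph_nat (real_complex R)); case: (nu) hnu => u v /= u0.
  by rewrite mul0r subr0 pmulr_rlt0 ?ltr0n.
(* Since Re nu < 0, the arguments b, 1 - b nu and b - b nu all lie in the right half-plane. *)
have G1 b : (0 < b)%N -> Gamma (b%:R : R[i]) != 0.
  by move=> b0; apply: Gamma_neq0; rewrite Re_nat ltr0n.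
have G2 b : (0 < b)%N -> Gamma (1 - b%:R * nu) != 0.
  move=> b0; apply: Gamma_neq0; rewrite raddfB /= subr_gt0.
  by rewrite (lt_trans (Re_nu b b0)).
have G3 b : (0 < b)%N -> Gamma (b%:R - b%:R * nu) != 0.
  move=> b0; apply: Gamma_neq0; rewrite raddfB /= Re_nat subr_gt0.
  by rewrite (lt_trans (Re_nu b b0)) ?ltr0n.
rewrite /Qcoef; move: (@Gamma R) G1 G2 G3 => G G1 G2 G3.
pose g b := G b%:R * G (1 - b%:R * nu) / G (b%:R - b%:R * nu).
(* The system matrix is [d b * P b l]: the factor depends on the row only, so the inverse is [S]
   with column l divided by [d l]. *)
pose d b := - g b * (x ^ (1 - b%:Z) / (1 - x)).
have xE b : (0 < b)%N -> x ^ (1 - b%:Z) = (x ^+ (b - 1))^-1.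
  by case: b => // b _; rewrite subn1 /= exprnN intS opprD addrA subrr add0r.
have d0 b : (0 < b)%N -> d b != 0.
  move=> b0; have g0 : g b != 0.
    exact: mulf_neq0 (mulf_neq0 (G1 b b0) (G2 b b0)) (invr_neq0 (G3 b b0)).
  by rewrite mulf_neq0 ?oppr_eq0 // xE // mulf_neq0 ?invr_eq0 ?expf_neq0.
pose P b l := (-1) ^+ l * 'C(b, l)%:R *
  hypergeom_poly (b - l) (- (b%:R * nu)) (- b%:R) x.
pose S b l := (-1) ^+ l * 'C(b, l)%:R *
  hypergeom_poly (b - l) (l%:R * nu) l%:R x.
have PS b k : (0 < k)%N -> (k <= b)%N ->
    \sum_(1 <= l < b.+1) P b l * S l k = (k == b)%:R.
  move=> k0 lekb; rewrite -(hypergeom_inverse nu x k0 lekb).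
  (* The term l = 0, present in [hypergeom_inverse] but not here, vanishes because C(0,k) = 0 for k
     > 0. *)
  rewrite -(big_mkord xpredT (fun l => P b l * S l k)) [RHS]big_ltn //.
  by rewrite [X in _ = X + _](_ : _ = 0) ?add0r // /S bin_small // mulr0 mul0r mulr0.
have iff := @triangular_system_iff _ (fun b l => d b * P b l)
  (fun b l => S b l / d l) K E.
apply: (iff_trans _ (iff_trans (iff _ _ _) _)) => {iff}.
- split=> h b b0; rewrite -(h b b0); apply: eq_bigr => l _; congr (_ * _);
    by rewrite /P /d /g; ring.
- move=> b b0; rewrite mulf_neq0 ?d0 // /P subnn hypergeom_poly0 binn !mulr1.
  by rewrite signr_eq0.
- move=> b k k0 lekb.
  (* Only the diagonal survives, and there the factor [d b / d k] is 1. *)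
  transitivity (d b / d k * \sum_(1 <= l < b.+1) P b l * S l k).
    by rewrite mulr_sumr; apply: eq_bigr => l _; ring.
  by rewrite PS //; case: eqP => [->|_]; rewrite ?mulr0 // mulr1 divff ?d0 ?(leq_trans k0).
- by move=> l k ltlk; rewrite /S bin_small // mulr0 !mul0r.
suff E12 b : (0 < b)%N -> \sum_(1 <= k < b.+1) S b k / d k * K k = (1 - x) *
       \sum_(1 <= l < b.+1)
         (-1) ^+ (l - 1) * 'C(b, l)%:R *
         hypergeom_poly (b - l) (l%:R * nu) l%:R x * x ^+ (l - 1) *
         (G (l%:R - l%:R * nu) / (G l%:R * G (1 - l%:R * nu))) *
         K l.
  by split=> h b b0; rewrite h // E12.
move=> b0; rewrite mulr_sumr; apply: eq_big_nat => l /andP[l0 _].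
rewrite mulrA; congr (_ * _); rewrite /S /d /g xE //.
(* The minus sign in [d l] accounts for the exponent l - 1 in the solution. *)
have -> : (-1) ^+ l = - (-1) ^+ (l - 1) :> R[i].
  by case: l l0 => // l _; rewrite subn1 exprS mulN1r.
have xl : x ^+ (l - 1) != 0 by rewrite expf_neq0.
move: (G1 l l0) (G2 l l0) (G3 l l0) xl x1.
move: (G l%:R) (G (1 - l%:R * nu)) (G (l%:R - l%:R * nu)) (x ^+ (l - 1)).
move: (1 - x) => y g1 g2 g3 xl h1 h2 h3 hx hy.
by field; rewrite h1 h2 h3 hx hy.
Qed.
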